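(* Let $\mathfrak{a}_1=(((x_1x_2)x_3)x_4)$, $\mathfrak{a}_2=((x_1(x_2x_3))x_4)$, $\mathfrak{a}_4=(x_1((x_2x_3)x_4))$, $\mathfrak{a}_5=(x_1(x_2(x_3x_4)))$ be the corresponding binary trees with $4$ leaves, and for $\{i,j\}\in\{\{1,2\},\{4,5\}\}$ let $\mathbf{Mag}^{\{i,j\}}=\mathbf{Mag}/_{\equiv}$ where $\equiv$ is the smallest operad congruence with $\mathfrak{a}_i\equiv\mathfrak{a}_j$. Then $$\mathcal{H}_{\mathbf{Mag}^{\{1,2\}}}(t)=\mathcal{H}_{\mathbf{Mag}^{\{4,5\}}}(t)=t\,\frac{1-t}{1-2t}.$$
   Context: A binary tree is either the leaf or an ordered pair of binary trees; here a product expression like $((x_1x_2)x_3)$ denotes the tree whose shape is its syntax tree (each product is an internal node, the $x_k$ are the leaves). $\mathbf{Mag}$ is the nonsymmetric set-theoretic operad of binary trees ($\mathbf{Mag}(n)$ = trees with $n$ leaves), with $\mathfrak{t}\circ_i\mathfrak{s}$ grafting the root of $\mathfrak{s}$ onto the $i$-th leaf of $\mathfrak{t}$. An operad congruence is an arity-preserving equivalence relation compatible with all partial compositions. The Hilbert series of an operad $\mathcal{O}$ with finite components is $\sum_{n\ge1}\#\mathcal{O}(n)\,t^n$. *)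

(* Defs.v *)
From HB Require Import structures.
From mathcomp Require Import all_boot all_order all_algebra generic_quotient.
From mathcomp Require Import finmap boolp classical_sets cardinality.
From mathcomp Require Import zify.

Set Implicit Arguments.
Unset Strict Implicit.
Unset Printing Implicit Defensive.

Import GRing.Theory.

(* A nonsymmetric set-operad is represented by the disjoint union of its
   components, with an arity function; [pcomp x i y] is x o_i y, with positions
   numbered from 1, and is only constrained for 1 <= i <= arity x. *)
Record nsOperad := NsOperad {
  carrier :> choiceType;
  arity : carrier -> nat;
  ounit : carrier;
  pcomp : carrier -> nat -> carrier -> carrier;
  arity_gt0 : forall x, 0 < arity x;
  arity_ounit : arity ounit = 1;
  arity_pcomp : forall x i y, 1 <= i <= arity x ->
    arity (pcomp x i y) = (arity x + arity y).-1;
  pcomp_nested : forall x i y j z, 1 <= i <= arity x -> 1 <= j <= arity y ->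
    pcomp (pcomp x i y) (i + j).-1 z = pcomp x i (pcomp y j z);
  pcomp_parallel : forall x i y j z, 1 <= i -> i < j -> j <= arity x ->
    pcomp (pcomp x i y) (j + arity y).-1 z = pcomp (pcomp x j z) i y;
  ounit_pcomp : forall x, pcomp ounit 1 x = x;
  pcomp_ounit : forall x i, 1 <= i <= arity x -> pcomp x i ounit = x
}.

Definition component (O : nsOperad) (n : nat) : set O :=
  [set x | arity x = n]%classic.
Arguments component : clear implicits.

Record congruence (O : nsOperad) (R : O -> O -> Prop) : Prop := Congruence {
  cong_refl : forall x, R x x;
  cong_sym : forall x y, R x y -> R y x;
  cong_trans : forall x y z, R x y -> R y z -> R x z;
  cong_arity : forall x y, R x y -> arity x = arity y;
  cong_pcomp : forall x x' i y y', R x x' -> R y y' -> 1 <= i <= arity x ->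
    R (pcomp x i y) (pcomp x' i y')
}.

Definition gen_congruence (O : nsOperad) (S : O -> O -> Prop) (x y : O) : Prop :=
  forall R, congruence R -> (forall u v, S u v -> R u v) -> R x y.

(* If S relates elements of different arities, no congruence contains S, and
   [gen_congruence S], an intersection of no relations, is the full relation. *)
Lemma gen_congruenceP (O : nsOperad) (S : O -> O -> Prop) :
  (forall u v, S u v -> arity u = arity v) -> congruence (gen_congruence S).
Proof.
move=> Sar; split.
- by move=> x R cR _; apply: cong_refl cR _.
- by move=> x y xy R cR SR; apply: (cong_sym cR); apply: xy.
- by move=> x y z xy yz R cR SR; apply: (cong_trans cR (xy R cR SR) (yz R cR SR)).
- move=> x y xy; apply: (xy (fun x y => arity x = arity y)) => //.
  split=> //= [u v w -> //|u u' i v v' uu' vv' iu].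
  by rewrite !arity_pcomp -?uu' // vv'.
- move=> x x' i y y' xx' yy' ix R cR SR.
  by apply: (cong_pcomp cR) => //; [apply: xx'|apply: yy'].
Qed.

Section Quotient.
Variables (O : nsOperad) (R : O -> O -> Prop) (cR : congruence R).

Let e : rel O := fun x y => `[< R x y >].

Let e_refl : reflexive e. Proof. by move=> x; apply/asboolP/(cong_refl cR). Qed.
Let e_sym : symmetric e.
Proof. by move=> x y; apply/asboolP/asboolP => /(cong_sym cR). Qed.
Let e_trans : transitive e.
Proof.
by move=> y x z /asboolP xy /asboolP yz; apply/asboolP/(cong_trans cR xy yz).
Qed.

Definition cong_equiv : equiv_rel O := EquivRel e e_refl e_sym e_trans.

Definition quot_carrier : choiceType := {eq_quot cong_equiv}%qT.

Local Notation Q := {eq_quot cong_equiv}%qT.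
Local Notation cl := (\pi_(Q)%qT : O -> Q).

Definition quot_arity (x : quot_carrier) : nat := arity (repr (x : Q)).
Definition quot_pcomp (x : quot_carrier) (i : nat) (y : quot_carrier) :
  quot_carrier := cl (pcomp (repr (x : Q)) i (repr (y : Q))).

Lemma quot_eqP (x y : O) : cl x = cl y <-> R x y.
Proof. by split=> [/eqmodP/asboolP|xy] //; apply/eqmodP/asboolP. Qed.

Let repr_cl (x : O) : R (repr (cl x)) x.
Proof. by apply/quot_eqP; rewrite reprK. Qed.

Lemma quot_arityE (x : O) : quot_arity (cl x) = arity x.
Proof. exact: (cong_arity cR (repr_cl x)). Qed.

Lemma quot_pcompE (x : O) i (y : O) : 1 <= i <= arity x ->
  quot_pcomp (cl x) i (cl y) = cl (pcomp x i y).
Proof.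
move=> ix; apply/quot_eqP/(cong_pcomp cR); do ?exact: repr_cl.
by rewrite (cong_arity cR (repr_cl x)).
Qed.

Let clP (x : quot_carrier) : {y : O | x = cl y}.
Proof. by exists (repr (x : Q)); rewrite reprK. Qed.

Lemma quot_arity_gt0 x : 0 < quot_arity x.
Proof. exact: arity_gt0. Qed.

Lemma quot_arity_ounit : quot_arity (cl (ounit O)) = 1.
Proof. by rewrite quot_arityE arity_ounit. Qed.

Lemma quot_arity_pcomp x i y : 1 <= i <= quot_arity x ->
  quot_arity (quot_pcomp x i y) = (quot_arity x + quot_arity y).-1.
Proof.
have [u ->] := clP x; have [v ->] := clP y.
rewrite quot_arityE => iu.
by rewrite quot_pcompE // !quot_arityE arity_pcomp.
Qed.

Lemma quot_pcomp_nested x i y j z :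
  1 <= i <= quot_arity x -> 1 <= j <= quot_arity y ->
  quot_pcomp (quot_pcomp x i y) (i + j).-1 z = quot_pcomp x i (quot_pcomp y j z).
Proof.
have [u ->] := clP x; have [v ->] := clP y; have [w ->] := clP z.
rewrite !quot_arityE => iu jv.
by rewrite !quot_pcompE ?pcomp_nested // arity_pcomp //; lia.
Qed.

Lemma quot_pcomp_parallel x i y j z : 1 <= i -> i < j -> j <= quot_arity x ->
  quot_pcomp (quot_pcomp x i y) (j + quot_arity y).-1 z =
  quot_pcomp (quot_pcomp x j z) i y.
Proof.
have [u ->] := clP x; have [v ->] := clP y; have [w ->] := clP z.
rewrite !quot_arityE => i1 ij ju.
have v0 := arity_gt0 v; have w0 := arity_gt0 w.
by rewrite !quot_pcompE ?pcomp_parallel // ?arity_pcomp; lia.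
Qed.

Lemma quot_ounit_pcomp x : quot_pcomp (cl (ounit O)) 1 x = x.
Proof.
by have [u ->] := clP x; rewrite quot_pcompE ?arity_ounit ?ounit_pcomp.
Qed.

Lemma quot_pcomp_ounit x i : 1 <= i <= quot_arity x ->
  quot_pcomp x i (cl (ounit O)) = x.
Proof.
have [u ->] := clP x; rewrite quot_arityE => iu.
by rewrite quot_pcompE ?pcomp_ounit.
Qed.

Definition quot_operad : nsOperad :=
  NsOperad quot_arity_gt0 quot_arity_ounit quot_arity_pcomp quot_pcomp_nested
    quot_pcomp_parallel quot_ounit_pcomp quot_pcomp_ounit.

End Quotient.

Inductive tree := Leaf | Node of tree & tree.

Fixpoint tree_encode (t : tree) : GenTree.tree unit :=
  match t with
  | Leaf => GenTree.Leaf tt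
  | Node l r => GenTree.Node 0 [:: tree_encode l; tree_encode r]
  end.

Fixpoint tree_decode (g : GenTree.tree unit) : option tree :=
  match g with
  | GenTree.Leaf _ => Some Leaf
  | GenTree.Node _ [:: l; r] =>
      if (tree_decode l, tree_decode r) is (Some l', Some r')
      then Some (Node l' r') else None
  | _ => None
  end.

Lemma tree_encodeK : pcancel tree_encode tree_decode.
Proof. by elim=> //= l -> r ->. Qed.

HB.instance Definition _ := Countable.copy tree (pcan_type tree_encodeK).

Fixpoint leaves (t : tree) : nat :=
  if t is Node l r then leaves l + leaves r else 1.

Fixpoint graft (t : tree) (i : nat) (s : tree) : tree :=
  match t with
  | Leaf => s
  | Node l r => if i <= leaves l then Node (graft l i s) r
                else Node l (graft r (i - leaves l) s)
  end.

Lemma leaves_gt0 t : 0 < leaves t.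
Proof. by elim: t => //= l IHl r IHr; lia. Qed.

Lemma leaves_graft t i s : 1 <= i <= leaves t ->
  leaves (graft t i s) = (leaves t + leaves s).-1.
Proof.
elim: t i => [|l IHl r IHr] i //= it.
have l0 := leaves_gt0 l; have r0 := leaves_gt0 r; have s0 := leaves_gt0 s.
by case: leqP => il /=; [rewrite IHl|rewrite IHr]; lia.
Qed.

Lemma graft_nested x i y j z : 1 <= i <= leaves x -> 1 <= j <= leaves y ->
  graft (graft x i y) (i + j).-1 z = graft x i (graft y j z).
Proof.
elim: x i => [|l IHl r IHr] i /= ix jy; first by congr graft; lia.
case: leqP => il /=.
  by rewrite leaves_graft ?ifT ?IHl //; lia.
rewrite ifF; last by lia.
by rewrite -IHr; [congr (Node l (graft _ _ z)); lia|lia|lia].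
Qed.

Lemma graft_parallel x i y j z : 1 <= i -> i < j -> j <= leaves x ->
  graft (graft x i y) (j + leaves y).-1 z = graft (graft x j z) i y.
Proof.
have y0 := leaves_gt0 y; have z0 := leaves_gt0 z.
elim: x i j => [|l IHl r IHr] i j /= i1 ij jx; first by lia.
have [il|il] := leqP i (leaves l); have [jl|jl] := leqP j (leaves l) => /=.
- have -> : i <= leaves (graft l j z) by rewrite leaves_graft; lia.
  rewrite leaves_graft ?IHl //; last by lia.
  by have -> : (j + leaves y).-1 <= (leaves l + leaves y).-1 by lia.
- rewrite il leaves_graft; last by lia.
  have -> : ((j + leaves y).-1 <= (leaves l + leaves y).-1) = false by lia.
  by congr (Node _ (graft r _ z)); lia.
- by lia.
- have -> : ((j + leaves y).-1 <= leaves l) = false by lia.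
  have -> : (i <= leaves l) = false by lia.
  rewrite -IHr; [|lia..].
  by congr (Node l (graft _ _ z)); lia.
Qed.

Lemma graft_leaf x i : 1 <= i <= leaves x -> graft x i Leaf = x.
Proof.
elim: x i => [|l IHl r IHr] i //= ix.
by case: leqP => il; [rewrite IHl|rewrite IHr] => //; lia.
Qed.

Definition Mag : nsOperad :=
  @NsOperad tree leaves Leaf graft leaves_gt0 erefl leaves_graft graft_nested
    graft_parallel (fun x => erefl) graft_leaf.

Definition a1 : Mag := Node (Node (Node Leaf Leaf) Leaf) Leaf.
Definition a2 : Mag := Node (Node Leaf (Node Leaf Leaf)) Leaf.
Definition a4 : Mag := Node Leaf (Node (Node Leaf Leaf) Leaf).
Definition a5 : Mag := Node Leaf (Node Leaf (Node Leaf Leaf)).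

Definition pair_rel (T : Type) (a b : T) (x y : T) : Prop := x = a /\ y = b.

Lemma pair_rel_arity (O : nsOperad) (a b : O) : arity a = arity b ->
  forall x y, pair_rel a b x y -> arity x = arity y.
Proof. by move=> ab x y [-> ->]. Qed.

Definition quot_pair (O : nsOperad) (a b : O) (ab : arity a = arity b) :
  nsOperad := quot_operad (gen_congruenceP (pair_rel_arity ab)).

Definition Mag12 : nsOperad := @quot_pair Mag a1 a2 erefl.
Definition Mag45 : nsOperad := @quot_pair Mag a4 a5 erefl.

Local Open Scope ring_scope.

(* The formal power series \sum_n (f n) t^n. *)
Definition series (R : Type) := nat -> R.

Definition poly_series (R : nzRingType) (p : {poly R}) : series R := fun n => p`_n.

Definition series_mul (R : nzRingType) (f g : series R) : series R :=
  fun n => \sum_(i < n.+1) f i * g (n - i)%N.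

(* [series_inv_seq f n] lists the first n coefficients b_k of 1 / f, given by
   b_0 = 1 / f_0 and b_n = - (\sum_(k < n) f_(n-k) b_k) / f_0. *)
Fixpoint series_inv_seq (R : comUnitRingType) (f : series R) (n : nat) : seq R :=
  if n is m.+1 then
    let s := series_inv_seq f m in
    rcons s ((f 0%N)^-1 * ((m == 0%N)%:R - \sum_(k < m) f (m - k)%N * s`_k))
  else [::].

Definition series_inv (R : comUnitRingType) (f : series R) : series R :=
  fun n => (series_inv_seq f n.+1)`_n.

Definition series_div (R : comUnitRingType) (f g : series R) : series R :=
  series_mul f (series_inv g).

Lemma size_series_inv_seq (R : comUnitRingType) (f : series R) n :
  size (series_inv_seq f n) = n.
Proof. by elim: n => //= n IHn; rewrite size_rcons IHn. Qed.

Lemma nth_series_inv_seq (R : comUnitRingType) (f : series R) n k :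
  (k < n)%N -> (series_inv_seq f n)`_k = series_inv f k.
Proof.
elim: n => // n IHn; rewrite ltnS leq_eqVlt => /orP[/eqP -> //|kn].
by rewrite /= nth_rcons size_series_inv_seq kn IHn.
Qed.

Lemma series_mulV (R : comUnitRingType) (f : series R) :
  f 0%N \is a GRing.unit -> series_mul f (series_inv f) = poly_series 1.
Proof.
move=> uf; apply/funext => n; rewrite /series_mul /poly_series coef1.
rewrite (reindex_inj rev_ord_inj) big_ord_recr /= subSS subnn.
rewrite subn0 {2}/series_inv /= nth_rcons size_series_inv_seq ltnn eqxx.
rewrite mulrA divrr // mul1r.
rewrite [X in X + _](_ : _ = \sum_(k < n) f (n - k)%N * (series_inv_seq f n)`_k).
  by rewrite addrC subrK.
apply: eq_bigr => k _; rewrite nth_series_inv_seq //.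
by rewrite subSS subKn // ltnW.
Qed.

(* [fset_set] of an infinite set is empty: a nonzero coefficient is the genuine
   cardinality of a finite component. *)
Definition hilbert_series (O : nsOperad) : series int :=
  fun n => if n is 0 then 0 else (#|` fset_set (component O n)|)%:Z.

(* Main.v *)
Require Import Defs.
From mathcomp Require Import all_boot all_order all_algebra.
From mathcomp Require Import generic_quotient finmap boolp classical_sets.
From mathcomp Require Import cardinality zify ring.

(** The relation [a1 = a2] says that [(xy)z = x(yz)] holds in every left subtree,
    so a left subtree may be replaced by a left comb.  Hence the class of a tree
    is determined by the numbers of leaves of the subtrees hanging to the left of
    its rightmost branch, which the relation preserves; they form a composition
    of (number of leaves - 1), and every composition occurs.  Reflecting trees
    exchanges [a1], [a2] with [a5], [a4]. *)

Set Implicit Arguments.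
Unset Strict Implicit.
Unset Printing Implicit Defensive.

Import GRing.Theory.

(** * Invariant: leaf counts along the rightmost branch *)

Fixpoint spine (t : tree) : seq nat :=
  if t is Node l r then leaves l :: spine r else [::].

Lemma leaves_spine t : leaves t = (sumn (spine t)).+1.
Proof. by elim: t => //= l _ r ->; rewrite addnS. Qed.

Lemma spine_gt0 t : all (leq 1) (spine t).
Proof. by elim: t => //= l _ r ->; rewrite leaves_gt0. Qed.

(** A graft inside a left subtree changes only its leaf count, and the spine of the grafted tree
    determines that count; a graft further right is handled by induction. *)
Lemma spine_congruence : @congruence Mag (fun x y => spine x = spine y).
Proof.
split=> //= [x y z -> //|x y xy|]; first by rewrite !leaves_spine xy.
elim=> [|l IHl r IHr] [|l' r'] i y y' //= [ll' rr'] yy' ix.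
have yy'_leaves : leaves y = leaves y' by rewrite !leaves_spine yy'.
rewrite -ll'; case: leqP => il /=; rewrite -?ll'.
  by rewrite !leaves_graft -?ll' ?yy'_leaves ?rr' //; lia.
by rewrite (IHr r' _ y y') //=; lia.
Qed.

(** * Reduction to normal forms *)

Definition left_comb (n : nat) : tree := iter n.-1 (Node^~ Leaf) Leaf.

Definition comb (s : seq nat) : tree := foldr (Node \o left_comb) Leaf s.

Lemma leaves_left_comb n : 0 < n -> leaves (left_comb n) = n.
Proof.
by case: n => // n _; rewrite /left_comb /=; elim: n => //= n ->; rewrite addn1.
Qed.

Lemma spine_comb s : all (leq 1) s -> spine (comb s) = s.
Proof. by elim: s => //= n s IHs /andP[n0 /IHs ->]; rewrite leaves_left_comb. Qed.

Section MagCongruence.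
Variables (R : Mag -> Mag -> Prop) (cR : congruence R).

Lemma cong_Node l l' r r' : R l l' -> R r r' -> R (Node l r) (Node l' r').
Proof.
move=> ll' rr'.
(* Leaf 2 is filled before leaf 1, so that position 1 does not shift. *)
have /(cong_pcomp cR) H := @cong_pcomp _ _ cR (Node Leaf Leaf : Mag)
  (Node Leaf Leaf) 2 _ _ (cong_refl cR _) rr' isT.
exact: (H 1 _ _ ll').
Qed.

Hypothesis R12 : R a1 a2.

(** An instance of [R12]: [r], [s], [q], [p] are grafted on leaves 4, 3, 2, 1, from right to left so
    that the remaining leaves keep their numbers. *)
Lemma cong_left_assoc p q s r :
  R (Node (Node (Node p q) s) r) (Node (Node p (Node q s)) r).
Proof.
have step x y i z : R x y -> 1 <= i <= leaves x -> R (graft x i z) (graft y i z).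
  by move=> xy ix; apply: (cong_pcomp cR) => //; apply: (cong_refl cR).
have := R12.
move/(@step _ _ 4 r)/(_ isT) => /=.
move/(@step _ _ 3 s) => /= /(_ isT).
move/(@step _ _ 2 q) => /= /(_ isT).
by move/(@step _ _ 1 p) => /= /(_ isT).
Qed.

Lemma cong_left_comb l r : R (Node l r) (Node (left_comb (leaves l)) r).
Proof.
(* Induction on [q]: reassociating [p (q1 q2)] into [(p q1) q2] lets [p] absorb [q1], then [q2]. The
   right sibling [r] stays arbitrary because reassociation is available only inside a left
   subtree. *)
have absorb q : forall p n, 0 < n ->
    (forall r, R (Node p r) (Node (left_comb n) r)) ->
    forall r, R (Node (Node p q) r) (Node (left_comb (n + leaves q)) r).
  elim: q => [|q1 IH1 q2 IH2] p n n0 pn t /=.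
    rewrite addn1; case: n n0 pn => // n _ pn.
    by apply: cong_Node; [apply: pn|apply: (cong_refl cR)].
  apply: (cong_trans cR (cong_sym cR (cong_left_assoc p q1 q2 t))).
  by rewrite addnA; apply: IH2; [lia|apply: IH1].
elim: l r => [|p IHp q _] r /=; first exact: (cong_refl cR).
by apply: absorb => //; apply: leaves_gt0.
Qed.

Lemma cong_comb_spine t : R t (comb (spine t)).
Proof.
elim: t => [|l _ r IHr] /=; first exact: (cong_refl cR).
apply: (cong_trans cR (cong_left_comb l r)).
by apply: cong_Node => //; apply: (cong_refl cR).
Qed.

Lemma cong_of_spine x y : spine x = spine y -> R x y.
Proof.
move=> xy; apply: (cong_trans cR (cong_comb_spine x)).
by rewrite xy; apply: (cong_sym cR (cong_comb_spine y)).
Qed.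

End MagCongruence.

Lemma gen_a1_a2P (x y : Mag) :
  gen_congruence (pair_rel a1 a2) x y <-> spine x = spine y.
Proof.
split=> [|xy R cR R12]; first by move/(_ _ spine_congruence); apply=> u v [-> ->].
by apply: (cong_of_spine cR) => //; apply: R12.
Qed.

(** * Transfer by reflection *)

Fixpoint mirror (t : tree) : tree :=
  if t is Node l r then Node (mirror r) (mirror l) else Leaf.

Lemma mirrorK : involutive mirror.
Proof. by elim=> //= l -> r ->. Qed.

Lemma leaves_mirror t : leaves (mirror t) = leaves t.
Proof. by elim: t => //= l -> r ->; rewrite addnC. Qed.

Lemma mirror_graft t i s : 1 <= i <= leaves t ->
  mirror (graft t i s) = graft (mirror t) ((leaves t).+1 - i) (mirror s).
Proof.
elim: t i => [|l IHl r IHr] i //= it; rewrite leaves_mirror.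
have l0 := leaves_gt0 l; have r0 := leaves_gt0 r.
case: leqP => il /=.
  rewrite ifF; last by lia.
  by rewrite IHl; [congr (Node _ (graft _ _ _)); lia|lia].
rewrite ifT; last by lia.
by rewrite IHr; [congr (Node (graft _ _ _) _); lia|lia].
Qed.

Lemma mirror_congruence (R : Mag -> Mag -> Prop) : congruence R ->
  @congruence Mag (fun x y => R (mirror x) (mirror y)).
Proof.
move=> cR; have arR x y : R (mirror x) (mirror y) -> leaves x = leaves y.
  by move/(cong_arity cR); rewrite /= !leaves_mirror.
split=> // [x|x y|x y z|x x' i y y' xx' yy' /= ix].
- exact: (cong_refl cR).
- exact: (cong_sym cR).
- exact: (cong_trans cR).
rewrite !mirror_graft -?(arR _ _ xx') //.
by apply: (cong_pcomp cR) => //=; rewrite leaves_mirror; lia.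
Qed.

Lemma gen_a4_a5P (x y : Mag) :
  gen_congruence (pair_rel a4 a5) x y <-> spine (mirror x) = spine (mirror y).
Proof.
split=> [|xy R cR R45].
  by move/(_ _ (mirror_congruence spine_congruence)); apply=> u v [-> ->].
rewrite -[x]mirrorK -[y]mirrorK.
apply: (cong_of_spine (mirror_congruence cR)) => //.
(* Reflection sends [a1] to [a5] and [a2] to [a4], so the pair appears in reverse order. *)
exact/(cong_sym cR)/R45.
Qed.

(** * Enumeration of compositions by binary words *)

(* The composition of [k + size w] with first part at least [k] encoded by [w]:
   [true] enlarges the current part, initially [k], and [false] starts a new one. *)
Fixpoint composition (k : nat) (w : bitseq) : seq nat :=
  if w is b :: w' then
    if b then composition k.+1 w' else k :: composition 1 w'
  else [:: k].

Lemma sumn_composition k w : sumn (composition k w) = k + size w.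
Proof.
elim: w k => [|[] w IHw] k //=; first by rewrite IHw addnS.
by rewrite IHw.
Qed.

Lemma composition_gt0 k w : 0 < k -> all (leq 1) (composition k w).
Proof. by elim: w k => [|[] w IHw] k k0 /=; rewrite ?k0 ?IHw. Qed.

Lemma head_composition k w : k <= head 0 (composition k w).
Proof. by elim: w k => [|[] w IHw] k //=; apply: ltnW. Qed.

(** At the first letter where two words differ, [false] closes the current part at its present
    value, while [true] forces it to be strictly larger. *)
Lemma composition_inj k : injective (composition k).
Proof.
have headN m w s : composition m.+1 w <> m :: s.
  by move=> E; have := head_composition m.+1 w; rewrite E /= ltnn.
have neq0 m w : composition m w <> [::].
  by elim: w m => [|[] w IHw] m //=.
move=> w; elim: w k => [|[] w IHw] k [|[] w'] //=.
- by move/esym/headN.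
- by case=> /esym/neq0.
- by move/headN.
- by move/IHw ->.
- by move/headN.
- by case=> /neq0.
- by move/esym/headN.
- by case=> /IHw ->.
Qed.

Lemma composition_nseq k d w :
  composition k (nseq d true ++ w) = composition (k + d) w.
Proof. by elim: d k => [|d IHd] k /=; rewrite ?addn0 // IHd addSnnS. Qed.

(** A run of [m - k] letters [true] raises the first part to [m]; [false] then opens the next part
    at 1, which is at most its positive target. *)
Lemma composition_surj k m s : k <= m -> all (leq 1) s ->
  exists w, composition k w = m :: s.
Proof.
elim: s k m => [|n s IHs] k m km /=.
  by exists (nseq (m - k) true ++ [::]); rewrite composition_nseq subnKC.
case/andP=> n0 /(IHs _ _ n0)[w wE]; exists (nseq (m - k) true ++ false :: w).
by rewrite composition_nseq subnKC //= wE.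
Qed.

Definition compositions (n : nat) : seq (seq nat) :=
  if n is m.+1 then [seq composition 1 w | w : m.-tuple bool] else [:: [::]].

Lemma size_compositions n : size (compositions n) = 2 ^ n.-1.
Proof. by case: n => //= n; rewrite size_map -cardE card_tuple card_bool. Qed.

Lemma uniq_compositions n : uniq (compositions n).
Proof.
case: n => //= n; rewrite map_inj_uniq ?enum_uniq //.
by move=> u v /composition_inj/val_inj.
Qed.

Lemma mem_compositions n s :
  (s \in compositions n) = all (leq 1) s && (sumn s == n).
Proof.
case: n => [|n] /=.
  by rewrite inE; case: s => //= -[|m] s //=; rewrite andbF.
apply/mapP/andP => [[w _ ->]|[]].
  by rewrite composition_gt0 // sumn_composition size_tuple.
case: s => [|m s] //= /andP[m0 s0] /eqP sn.
have [w wE] := composition_surj m0 s0.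
have wn : size w == n.
  by apply/eqP; have := sumn_composition 1 w; rewrite wE /= sn; lia.
by exists (Tuple wn); rewrite ?mem_enum ?wE.
Qed.

(** * From invariants to Hilbert series *)

Lemma card_fset_set_seq (T : choiceType) (A : set T) (s : seq T) :
  uniq s -> (forall x, A x <-> x \in s) -> #|` fset_set A| = size s.
Proof.
move=> s_uniq As; have -> : A = [set` seq_fset tt s]%classic.
  apply/seteqP; split=> x /= xs; [move/As: xs|apply/As; move: xs];
    by rewrite (seq_fsetE tt s x).
by rewrite set_fsetK size_seq_fset undup_id.
Qed.

(** The complete invariant [f], with section [g] on compositions, makes the classes of trees with
    [n.+1] leaves correspond to the compositions of [n]. For [n = 0] the truncated exponent counts
    the empty composition. *)
Lemma hilbert_series_quot_composition (R : Mag -> Mag -> Prop)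
    (cR : congruence R) (f : tree -> seq nat) (g : seq nat -> tree) :
    (forall x y, R x y <-> f x = f y) ->
    (forall x, all (leq 1) (f x)) -> (forall x, leaves x = (sumn (f x)).+1) ->
    (forall s, all (leq 1) s -> f (g s) = s) ->
  forall n, hilbert_series (quot_operad cR) n.+1 = Posz (2 ^ n.-1).
Proof.
move=> Rf f_gt0 leaves_f gK n; rewrite /hilbert_series; congr Posz.
pose cl (x : Mag) : quot_operad cR := \pi_({eq_quot cong_equiv cR})%qT x.
have clE x y : cl x = cl y <-> f x = f y.
  by rewrite -Rf; apply: (quot_eqP cR).
rewrite (@card_fset_set_seq _ _ [seq cl (g s) | s <- compositions n]).
- by rewrite size_map size_compositions.
- rewrite map_inj_in_uniq ?uniq_compositions // => s t.
  rewrite !mem_compositions => /andP[s0 _] /andP[t0 _] /clE.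
  by rewrite !gK.
move=> x; rewrite /component; split=> [xn|/mapP[s]].
  apply/mapP; exists (f (repr (x : {eq_quot cong_equiv cR}%qT))).
    rewrite mem_compositions f_gt0 -eqSS -leaves_f.
    exact/eqP.
  transitivity (cl (repr (x : {eq_quot cong_equiv cR}%qT))).
    by rewrite /cl reprK.
  by apply/clE; rewrite gK.
rewrite mem_compositions => /andP[s0 /eqP sn] ->.
by apply: (etrans (quot_arityE cR (g s))); rewrite /= leaves_f gK // sn.
Qed.

Local Open Scope ring_scope.

(** * Expansion of the rational function *)

Lemma series_mul_linear (R : comNzRingType) (a b : R) (g : series R) n :
  series_mul (poly_series (a%:P + b *: 'X)) g n.+1 = a * g n.+1 + b * g n.
Proof.
rewrite /series_mul /poly_series !big_ord_recl big1 => [|i _].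
  by rewrite !coefD !coefC !coefZ !coefX /= subn0 subSS subn0; ring.
by rewrite coefD coefC coefZ coefX /=; ring.
Qed.

Lemma series_inv_1B2X n :
  series_inv (poly_series (1 - 2%:R *: 'X : {poly int})) n = 2%:R ^+ n.
Proof.
have u0 : poly_series (1 - 2%:R *: 'X : {poly int}) 0%N = 1.
  by rewrite /poly_series coefB coef1 coefZ coefX mulr0 subr0.
have fV := @series_mulV _ (poly_series (1 - 2%:R *: 'X : {poly int})).
set g := series_inv _ in fV *.
(* The constant term 1 is a unit, so the product with the inverse can be compared with 1
   coefficientwise; this gives the recurrence [g n.+1 = 2 * g n]. *)
have {}fV k := congr1 (@^~ k) (fV (etrans (congr1 _ u0) (unitr1 _))).
elim: n => [|n IHn].
  by have := fV 0%N; rewrite /series_mul big_ord1 u0 mul1r /poly_series coef1.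
have := fV n.+1; rewrite -scaleNr -polyC1 series_mul_linear IHn.
rewrite /poly_series coef1 /= mul1r mulNr => /eqP.
by rewrite subr_eq0 exprS => /eqP.
Qed.

Lemma series_div_coef n :
  series_div (poly_series ('X * (1 - 'X))) (poly_series (1 - 2%:R *: 'X)) n =
  if n is m.+1 then Posz (2 ^ m.-1) else 0.
Proof.
rewrite /series_div /series_mul /poly_series.
case: n => [|[|n]]; rewrite !big_ord_recl ?big_ord0 ?big1;
  rewrite ?coefXM ?coefB ?coef1 ?coefX /= ?series_inv_1B2X ?mul0r //.
  (* Only the terms [t] and [-t^2] of the numerator contribute: [2^(n+1) - 2^n = 2^n]. *)
  by rewrite subSS subn0 !subSS subn0 exprS -natz natrX; ring.
by move=> i _; rewrite coefXM coefB coef1 coefX /= subr0 mul0r.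
Qed.

Theorem theorem4p2p1 :
  hilbert_series Mag12 =
    series_div (poly_series ('X * (1 - 'X))) (poly_series (1 - 2%:R *: 'X)) /\
  hilbert_series Mag45 =
    series_div (poly_series ('X * (1 - 'X))) (poly_series (1 - 2%:R *: 'X)).
Proof.
split; apply/funext => -[|n]; rewrite series_div_coef //.
  apply: (hilbert_series_quot_composition _ gen_a1_a2P) => *.
  - exact: spine_gt0.
  - exact: leaves_spine.
  - exact: spine_comb.
apply: (hilbert_series_quot_composition (g := mirror \o comb) _ gen_a4_a5P) => *.
- exact: spine_gt0.
- by rewrite -leaves_spine leaves_mirror.
- by rewrite /= mirrorK spine_comb.
Qed.
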